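(* $z_L(6,3)\ge 10$.
   Context: **Classical Zarankiewicz number.** For $m\ge n\ge 2$, $z(m,n)$ is the maximum number of edges in a bipartite graph with parts $S=[m]=\{1,\dots,m\}$ and $T=[n]=\{1,\dots,n\}$ that contains no $K_{2,2}$ (equivalently, no cycle $C_4$). **Limited augmented bipartite graphs.** Let $G_1=(S,T,E_1)$ with $S=[m]$, $T=[n]$ be a $C_4$-free bipartite graph with $|E_1|=z(m,n)$. A limited augmented bipartite graph $G=(S,T,E_1\cup E_2)$ augmented from $G_1$ consists of the set $E_1$ of 1-edges (pairs, or ''cells'', $(i,j)\in S\times T$) and a set $E_2$ of 2-edges. A 2-edge is a quadruple $(i,j;k,l)$ with $i,k\in S$, $j,l\in T$, where the case $i=k$ and $j=l$ is forbidden; it is regarded as an unordered pair of the two distinct cells $(i,j)$ and $(k,l)$, called its halves. It is nondegenerate if $i\ne k$ and $j\ne l$, row-degenerate if $i=k$ and $j\neq l$, and column-degenerate if $i\ne k$ and $j=l$. The simplicity condition is imposed: no 2-edge shares a cell with any 1-edge or with another 2-edge. **Generalized $C_4$-cycles.** A cell $(i,j)$ is occupied if $(i,j)\in E_1$ or $(i,j)$ is a half of some 2-edge in $E_2$. The graph $G$ contains a generalized $C_4$-cycle if any of the following holds: 1. There is a classical $C_4$-cycle formed by 1-edges. 2. There is a nondegenerate 2-edge $(i,j;k,l)\in E_2$ such that both cells $(i,l)$ and $(k,j)$ are occupied. 3. There are a 2-edge $(i,j;p,q)\in E_2$ (of any type) and a cell $(k,l)$ with $k\notin\{i,p\}$ and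 $l\notin\{j,q\}$ such that the five cells $(k,l),(k,j),(k,q),(i,l),(p,l)$ are all occupied; if the 2-edge is nondegenerate, these five cells must moreover be pairwise distinct. **Limited augmented Zarankiewicz number.** $z_L(m,n)$ is the maximum of $|E_1|+|E_2|$ over all $m\times n$ limited augmented bipartite graphs $G=(S,T,E_1\cup E_2)$ (augmented from a $C_4$-free graph with $|E_1|=z(m,n)$, satisfying the simplicity condition) that contain no generalized $C_4$-cycle. *)

(* Defs.v *)
From mathcomp Require Import all_boot.

Set Implicit Arguments.
Unset Strict Implicit.
Unset Printing Implicit Defensive.

(* A bipartite graph with parts [m] and [n] is given by its set of edges, a    *)
(* set of cells; the two parts are indexed from 0.                            *)
Definition cell (m n : nat) : finType := ('I_m * 'I_n)%type.

Definition has_C4 (m n : nat) (E : {set cell m n}) : bool :=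
  [exists i : 'I_m, exists k : 'I_m, exists j : 'I_n, exists l : 'I_n,
    [&& i != k, j != l,
        (i, j) \in E, (i, l) \in E, (k, j) \in E & (k, l) \in E]].

Definition zarankiewicz (m n : nat) : nat :=
  \max_(E : {set cell m n} | ~~ has_C4 E) #|E|.

(* The 2-edge (i,j;k,l) is the unordered pair [set (i, j); (k, l)] of its two  *)
(* halves; cardinality 2 excludes i = k and j = l, and nothing else, so that  *)
(* degenerate 2-edges are allowed.                                            *)
Definition is_two_edge (m n : nat) (e : {set cell m n}) : bool := #|e| == 2.

(* Simplicity is expressed by the last two clauses: no 2-edge meets E1, and   *)
(* distinct 2-edges are disjoint.                                             *)
Definition limited_augmented (m n : nat)
    (E1 : {set cell m n}) (E2 : {set {set cell m n}}) : bool :=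
  [&& ~~ has_C4 E1,
      #|E1| == zarankiewicz m n,
      [forall e in E2, is_two_edge e],
      [forall e in E2, [disjoint e & E1]] &
      trivIset E2].

Definition occupied (m n : nat)
    (E1 : {set cell m n}) (E2 : {set {set cell m n}}) : {set cell m n} :=
  E1 :|: cover E2.

Definition gen_C4_type2 (m n : nat)
    (E1 : {set cell m n}) (E2 : {set {set cell m n}}) : bool :=
  [exists i : 'I_m, exists j : 'I_n, exists k : 'I_m, exists l : 'I_n,
    [&& [set (i, j); (k, l)] \in E2, i != k, j != l,
        (i, l) \in occupied E1 E2 & (k, j) \in occupied E1 E2]].

Definition gen_C4_type3 (m n : nat)
    (E1 : {set cell m n}) (E2 : {set {set cell m n}}) : bool :=
  [exists i : 'I_m, exists j : 'I_n, exists p : 'I_m, exists q : 'I_n,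
   exists k : 'I_m, exists l : 'I_n,
    let five : seq (cell m n) :=
      [:: (k, l); (k, j); (k, q); (i, l); (p, l)] in
    [&& [set (i, j); (p, q)] \in E2,
        k \notin [:: i; p], l \notin [:: j; q],
        all (fun c => c \in occupied E1 E2) five &
        (i != p) && (j != q) ==> uniq five]].

Definition has_gen_C4 (m n : nat)
    (E1 : {set cell m n}) (E2 : {set {set cell m n}}) : bool :=
  [|| has_C4 E1, gen_C4_type2 E1 E2 | gen_C4_type3 E1 E2].

(* The index set of this maximum is nonempty: take E2 empty and E1 an         *)
(* extremal C4-free graph.                                                    *)
Definition zL (m n : nat) : nat :=
  \max_(G : {set cell m n} * {set {set cell m n}} |
          limited_augmented G.1 G.2 && ~~ has_gen_C4 G.1 G.2)
    (#|G.1| + #|G.2|).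

(* Main.v *)
Require Import Defs.
From mathcomp Require Import all_boot.

Set Implicit Arguments.
Unset Strict Implicit.
Unset Printing Implicit Defensive.

(** The number 10 is z(6,3) + 1: a single 2-edge can be added to a suitable
    extremal graph.  In a C4-free graph two rows never share a pair of columns,
    so the rows of degree d_i satisfy
    [\sum_i 'C(d_i, 2) <= 'C(n, 2)]; since [d <= 1 + 'C(d, 2)] this gives
    z(m,n) <= m + 'C(n, 2) ([zarankiewicz_le]), hence z(6,3) <= 9.  Equality is
    reached by [ext_graph]: three rows of degree 2, carrying the three pairs of
    columns, and three rows of degree 1.

    The added 2-edge [row_edge] fills the two empty cells of a row of degree 1.
    Being row-degenerate it cannot create a cycle of the second kind.  A cycle
    of the third kind would need another row k occupied in the two columns of
    the 2-edge and in a third one, that is, a full row, but every row other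
    than the one just filled has an empty cell. *)

Lemma leq_bin2 (d : nat) : d <= 1 + 'C(d, 2).
Proof.
elim: d => // -[//|d] IHd; rewrite binS bin1 addnA addnS ltnS.
exact: leq_trans IHd (leq_addr _ _).
Qed.

Definition row_nbhd (m n : nat) (E : {set cell m n}) (i : 'I_m) : {set 'I_n} :=
  [set j | (i, j) \in E].

Lemma card_row_nbhd (m n : nat) (E : {set cell m n}) :
  #|E| = \sum_i #|row_nbhd E i|.
Proof.
rewrite -sum1_card big_mkcond /=.
rewrite (eq_bigr (fun c => if (c.1, c.2) \in E then 1 else 0)) => [|[]//].
rewrite -(pair_bigA _ (fun i j => if (i, j) \in E then 1 else 0)) /=.
by apply: eq_bigr => i _; rewrite -sum1_card [RHS]big_mkcond /=;
   apply: eq_bigr => j _; rewrite inE.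
Qed.

Lemma C4_free_pair_rows (m n : nat) (E : {set cell m n}) (B : {set 'I_n}) :
  ~~ has_C4 E -> #|B| = 2 -> #|[set i | B \subset row_nbhd E i]| <= 1.
Proof.
move=> C4free /eqP/cards2P[j [l [jl ->]]]; apply/card_le1_eqP => i k.
rewrite !inE !subUset !sub1set !inE => /andP[ij il] /andP[kj kl].
apply/eqP/negPn/negP => ik; case/negP: C4free.
apply/existsP; exists i; apply/existsP; exists k.
apply/existsP; exists j; apply/existsP; exists l.
by rewrite eq_sym ik jl ij il kj kl.
Qed.

(** Double counting of the pairs (row i, 2-subset B of the columns) with i
    adjacent to all of B. *)
Lemma C4_free_sum_bin2 (m n : nat) (E : {set cell m n}) :
  ~~ has_C4 E -> \sum_i 'C(#|row_nbhd E i|, 2) <= 'C(n, 2).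
Proof.
move=> C4free.
have -> : \sum_i 'C(#|row_nbhd E i|, 2) =
    \sum_i \sum_(B : {set 'I_n} | #|B| == 2) (B \subset row_nbhd E i).
  apply: eq_bigr => i _; rewrite -cards_draws -sum1_card big_mkcond /=.
  rewrite [RHS]big_mkcond /=; apply: eq_bigr => B _.
  by rewrite inE; case: (B \subset _); case: (#|B| == 2).
rewrite exchange_big /=.
rewrite -[X in 'C(X, 2)]card_ord -card_draws -sum1_card.
rewrite [X in _ <= X](eq_bigl (fun B : {set 'I_n} => #|B| == 2)); last first.
  by move=> B; rewrite inE.
apply: leq_sum => B /eqP B2.
apply: leq_trans (C4_free_pair_rows C4free B2).
by rewrite -sum1dep_card [X in _ <= X]big_mkcond /=;
   apply: leq_sum => i _; case: ifP.
Qed.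

Lemma zarankiewicz_le (m n : nat) : zarankiewicz m n <= m + 'C(n, 2).
Proof.
apply/bigmax_leqP => E C4free; rewrite card_row_nbhd.
apply: leq_trans (leq_add (leqnn m) (C4_free_sum_bin2 C4free)).
rewrite -[X in X + _]card_ord -sum1_card -big_split /=.
by apply: leq_sum => i _; apply: leq_bin2.
Qed.

(** For i < 3, row i misses only column i; the last three rows meet
    only column 0. *)
Definition ext_graph : {set cell 6 3} :=
  [set c : cell 6 3 |
    if c.1 < 3 then c.1 != c.2 :> nat else c.2 == 0 :> nat].

(** The two cells of row 3 left empty by [ext_graph], as one 2-edge. *)
Definition row_edge : {set cell 6 3} :=
  [set c : cell 6 3 | (c.1 == 3 :> nat) && (c.2 != 0 :> nat)].

Lemma ext_graph_C4_free : ~~ has_C4 ext_graph.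
Proof.
apply/existsP => -[i /existsP[k /existsP[j /existsP[l]]]].
case/and5P=> ik jl; rewrite !inE /= => ij il /andP[kj kl].
have col_eq (a b : 'I_3) : a == b = (a == b :> nat) by [].
have row_eq (a b : 'I_6) : a == b = (a == b :> nat) by [].
(* A row of index at least 3 has its only cell in column 0, which excludes two
   distinct columns; below 3, the pair of columns determines the row. *)
move: ik jl ij il kj kl; rewrite col_eq row_eq.
case: (ltnP i 3) => [i3|_]; case: (ltnP k 3) => [k3|_].
- by case: i i3 => -[|[|[|]]] // ? _; case: k k3 => -[|[|[|]]] // ? _;
     case: j => -[|[|[|]]] // ?; case: l => -[|[|[|]]].
- by move=> _ /negP jl _ _ /eqP j0 /eqP l0; case: jl; rewrite j0 l0.
- by move=> _ /negP jl /eqP j0 /eqP l0; case: jl; rewrite j0 l0.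
- by move=> _ /negP jl /eqP j0 /eqP l0; case: jl; rewrite j0 l0.
Qed.

Lemma card_ext_graph : #|ext_graph| = 9.
Proof.
rewrite card_row_nbhd.
under eq_bigr => i _ do rewrite -sum1_card big_mkcond /=.
by rewrite !big_ord_recr !big_ord0 /= !inE.
Qed.

Lemma zarankiewicz_6_3 : zarankiewicz 6 3 = 9.
Proof.
apply/eqP; rewrite eqn_leq (zarankiewicz_le 6 3) /= -card_ext_graph.
exact: (leq_bigmax_cond (F := fun E : {set cell 6 3} => #|E|) _
          ext_graph_C4_free).
Qed.

Lemma card_row_edge : #|row_edge| = 2.
Proof.
rewrite card_row_nbhd.
under eq_bigr => i _ do rewrite -sum1_card big_mkcond /=.
by rewrite !big_ord_recr !big_ord0 /= !inE.
Qed.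

Lemma row_edge_halves (i p : 'I_6) (j q : 'I_3) :
  [set (i, j); (p, q)] = row_edge ->
  [/\ i = p, i = 3 :> nat & j != q].
Proof.
move=> eqe.
have : (i, j) \in row_edge by rewrite -eqe set21.
have : (p, q) \in row_edge by rewrite -eqe set22.
rewrite !inE /= => /andP[/eqP p3 _] /andP[/eqP i3 _].
have ip : i = p by apply: val_inj; rewrite /= i3 p3.
split=> //; apply/eqP => jq.
by have := card_row_edge; rewrite -eqe ip jq setUid cards1.
Qed.

Lemma occupiedE (c : cell 6 3) :
  c \in occupied ext_graph [set row_edge] =
  (c \in ext_graph) || (c \in row_edge).
Proof. by rewrite inE /cover big_set1. Qed.

(** Row k misses column k when k < 3, and column 1 when k > 3. *)
Lemma row_not_full (k : 'I_6) :
  k != 3 :> nat ->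
  exists l : 'I_3, (k, l) \notin occupied ext_graph [set row_edge].
Proof.
move=> k3; case: (ltnP k 3) => [k_lt|k_ge].
  exists (Ordinal k_lt).
  by rewrite occupiedE !inE /= k_lt eqxx (negPf k3).
by exists (inord 1); rewrite occupiedE !inE /= ltnNge k_ge inordK //= (negPf k3).
Qed.

Lemma ord3_cover (j q l x : 'I_3) :
  j != q -> ~~ ((l == j) || (l == q)) -> [|| x == l, x == j | x == q].
Proof.
by case: j => -[|[|[|]]] // ?; case: q => -[|[|[|]]] // ?;
   case: l => -[|[|[|]]] // ?; case: x => -[|[|[|]]].
Qed.

Lemma augmented_no_gen_C4 : ~~ has_gen_C4 ext_graph [set row_edge].
Proof.
rewrite /has_gen_C4 !negb_or ext_graph_C4_free /=; apply/andP; split.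
  apply/existsP => -[i /existsP[j /existsP[k /existsP[l]]]].
  case/and5P=> /set1P/row_edge_halves[ik _ _].
  by rewrite ik eqxx.
apply/existsP => -[i /existsP[j /existsP[p /existsP[q]]]].
case/existsP=> k /existsP[l] /and5P[/set1P/row_edge_halves[ip i3 jq]].
rewrite !inE negb_or => /andP[ki _] lj /and5P[kl kj kq _ _] _.
have k3 : k != 3 :> nat.
  by apply: contra ki => /eqP k3; apply/eqP/val_inj; rewrite /= k3 i3.
(* The empty cell of row k lies in one of the columns l, j, q. *)
have [x /negP[]] := row_not_full k3.
by have /or3P[] := ord3_cover x jq lj => /eqP->.
Qed.

Lemma augmented_limited : limited_augmented ext_graph [set row_edge].
Proof.
rewrite /limited_augmented ext_graph_C4_free card_ext_graph zarankiewicz_6_3.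
rewrite eqxx /=; apply/and3P; split.
- by apply/forall_inP => e /set1P->; rewrite /is_two_edge card_row_edge.
- apply/forall_inP => e /set1P->; rewrite disjoint_subset.
  apply/subsetP => c; rewrite !inE => /andP[/eqP-> c2]; exact: c2.
- by apply/trivIsetP => A B /set1P-> /set1P->; rewrite eqxx.
Qed.

Theorem mainTheorem6 : 10 <= zL 6 3.
Proof.
rewrite /zL; apply: (bigmax_sup (ext_graph, [set row_edge])).
  by rewrite augmented_limited augmented_no_gen_C4.
by rewrite card_ext_graph cards1.
Qed.
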